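(* For large clutter cross-sections, the threshold $\gamma$ for obtaining the maximum radar detection coverage probability $P_{DC}$ for a given radar transmitted power $P_{tx}$ and given bandwidth $BW$ should be adjusted based on the target distance $r_t$ using $$\gamma(r_t)=\frac{\pi\rho c\,r_t\,P_{tx}\,\mathcal{H}(r_t)\,\sigma_{t_{avg}}}{K_BT_s\,BW^2}.$$ Since $J$ becomes $0$ for high $\sigma_{c_{avg}}$, in that situation this expression is directly obtained from the optimum bandwidth formula $$BW=\sqrt{\frac{\pi\rho c\,(1-J)\,r_tP_{tx}\mathcal{H}(r_t)\sigma_{t_{avg}}}{K_BT_s\gamma}}.$$ The threshold $\gamma(r_t)$ is independent of the type of clutter cross-section distribution (the Weibull shape parameter $\alpha$) and, as far as the clutter is concerned, depends only on the density $\rho$ of the clutter scatterers.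
   Context: A monostatic radar with isotropic antennas has transmitted power $P_{tx}$, bandwidth $BW$, system noise temperature $T_s$ (noise $K_BT_sBW$, with $K_B$ the Boltzmann constant) and a narrow range resolution cell of size $\frac{c}{2BW}$, with $c$ the speed of light. A single target at distance $r_t$ has an exponentially distributed (Swerling 1) radar cross-section with mean $\sigma_{t_{avg}}$; $\mathcal{H}(r_t)$ is the path loss at distance $r_t$. Clutter scatterers form a homogeneous Poisson point process of density $\rho$, with random cross-sections $\sigma_c$ having Weibull density $$P(\sigma_c)=\frac{\alpha}{\sigma_{c_{avg}}}\left(\frac{\sigma_c}{\sigma_{c_{avg}}}\right)^{\alpha-1}\exp\left(-\left(\frac{\sigma_c}{\sigma_{c_{avg}}}\right)^{\alpha}\right),\quad\sigma_c>0,$$ with shape parameter $\alpha$ and average clutter cross-section $\sigma_{c_{avg}}$. Let $J=\int_0^\infty e^{-\gamma\sigma_c/\sigma_{t_{avg}}}P(\sigma_c)\,d\sigma_c$. The radar detection coverage probability $P_{DC}$ is the probability that the signal to clutter and noise ratio is at least the threshold $\gamma$, and is given by $$P_{DC}=\exp\left(\frac{-K_BT_s\,BW\,\gamma}{P_{tx}\mathcal{H}(r_t)\sigma_{t_{avg}}}\right)\exp\left(-2\pi\rho(1-J)r_t\frac{c}{2BW}\right).$$ The optimum bandwidth formula quoted in the claim is obtained by equating to zero the derivative of $\ln P_{DC}$ with respect to $BW$. *)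

(* Defs.v *)
From HB Require Import structures.
From mathcomp Require Import all_boot all_order all_algebra.
From mathcomp Require Import all_classical all_reals all_analysis.
Import Order.TTheory GRing.Theory Num.Theory.
Import numFieldNormedType.Exports.

Set Implicit Arguments.
Unset Strict Implicit.
Unset Printing Implicit Defensive.

Local Open Scope classical_set_scope.
Local Open Scope ring_scope.

(* Every parameter of the radar and of its target except the clutter, the
   target distance, the bandwidth and the detection threshold. *)
Record radar (R : realType) := Radar {
  boltzmann : R;
  light_speed : R;
  noise_temp : R;
  tx_power : R;
  path_loss : R -> R;
  target_rcs : R; (* mean of the exponentially distributed cross-section *)
  boltzmann_gt0 : 0 < boltzmann;
  light_speed_gt0 : 0 < light_speed;
  noise_temp_gt0 : 0 < noise_temp;
  tx_power_gt0 : 0 < tx_power;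
  path_loss_gt0 : forall r, 0 < r -> 0 < path_loss r;
  target_rcs_gt0 : 0 < target_rcs
}.

Section Radar.
Context {R : realType}.
Implicit Types (S : radar R) (alpha sc rho rt j gamma BW x : R).

(* [sc] is the parameter written sigma_c_avg in the density; it is the scale
   of the Weibull law, and equals its mean only when alpha = 1. *)
Definition weibull_density alpha sc x : R :=
  alpha / sc * (x / sc) `^ (alpha - 1) * expR (- (x / sc) `^ alpha).

Definition clutter_J S alpha sc gamma : R :=
  \int[lebesgue_measure]_(x in `]0, +oo[)
    (expR (- (gamma * x / target_rcs S)) * weibull_density alpha sc x).

(* The coverage probability as a function of the value [j] of the integral J,
   so that it can be read both at the actual J and at its limit value 0. *)
Definition coverage_at S rho rt j gamma BW : R :=
  expR (- (boltzmann S * noise_temp S * BW * gamma) /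
        (tx_power S * path_loss S rt * target_rcs S)) *
  expR (- (2 * pi * rho * (1 - j) * rt * (light_speed S / (2 * BW)))).

Definition coverage S rho alpha sc rt gamma BW : R :=
  coverage_at S rho rt (clutter_J S alpha sc gamma) gamma BW.

Definition opt_bandwidth S rho rt j gamma : R :=
  Num.sqrt ((pi * rho * light_speed S * (1 - j) * rt * tx_power S *
             path_loss S rt * target_rcs S) /
            (boltzmann S * noise_temp S * gamma)).

Definition threshold S rho BW rt : R :=
  (pi * rho * light_speed S * rt * tx_power S * path_loss S rt *
   target_rcs S) / (boltzmann S * noise_temp S * BW ^+ 2).

Definition log_stationary (P : R -> R) BW : Prop :=
  is_derive BW (1 : R) (fun b => ln (P b)) 0.

Definition maximizes (P : R -> R) BW : Prop :=
  0 < BW /\ forall b, 0 < b -> P b <= P BW.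

End Radar.

(* Main.v *)
(* As a function of the bandwidth, -ln P_DC = a BW + c / BW with a > 0, and
   if a b ^ 2 = c then a x + c / x - (a b + c / b) = a (x - b) ^ 2 / x; so
   stationarity and maximality both amount to a BW ^ 2 = c, that is
   gamma = T (1 - J gamma) with T the claimed threshold.  J is a Laplace
   transform in gamma, hence convex and nonincreasing, with J 0 <= 1, and
   J (T / 2) -> 0 when sc -> +oo.  Hence the equation eventually has exactly
   one positive solution; it is at least T / 2, and therefore
   T - gamma = T * J gamma <= T * J (T / 2) -> 0. *)

Require Import Defs.
From HB Require Import structures.
From mathcomp Require Import all_boot all_order all_algebra.
From mathcomp Require Import all_classical all_reals all_analysis.
From mathcomp Require Import measurable_realfun ring lra.
Import Order.TTheory GRing.Theory Num.Theory.
Import numFieldNormedType.Exports.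

Set Implicit Arguments.
Unset Strict Implicit.
Unset Printing Implicit Defensive.

Local Open Scope classical_set_scope.
Local Open Scope ring_scope.

(** * Real powers: growth and continuity *)

Lemma cvgy_powR (R : realType) (p : R) : 0 < p ->
  (x : R) `^ p @[x --> +oo] --> +oo.
Proof.
move=> p0; apply/cvgryPge => A; near=> x.
(* [Num.max A 1] is nonnegative, hence the [p]-th power of its [p]-th root; any [x] beyond that root
   will do. *)
rewrite (@le_trans _ _ (Num.max A 1))// ?le_max ?lexx//.
have M0 : 0 <= Num.max A 1 by rewrite le_max ler01 orbT.
have -> : Num.max A 1 = (Num.max A 1 `^ p^-1) `^ p.
  by rewrite -powRrM mulVf ?lt0r_neq0// powRr1.
have yx : Num.max A 1 `^ p^-1 <= x.
  by near: x; apply: nbhs_pinfty_ge; exact: num_real.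
by apply: ge0_ler_powR; rewrite ?nnegrE ?(ltW p0)// ?powR_ge0//.
Unshelve. all: by end_near. Qed.

Lemma continuous_powR (R : realType) (p x : R) : 0 < x ->
  {for x, continuous (@powR R ^~ p)}.
Proof.
move=> x0; apply: differentiable_continuous; apply/derivable1_diffP.
by apply: derivable_powR; rewrite in_itv/= x0.
Qed.

(** * The Weibull law: density, tail and total mass *)

Section Weibull.
Variables (R : realType) (alpha sc : R).
Hypotheses (alpha0 : 0 < alpha) (sc0 : 0 < sc).
Local Notation mu := (@lebesgue_measure R).
Local Notation D := `](0 : R), +oo[%classic.
Local Notation w := (weibull_density alpha sc).
Implicit Types a x s : R.

Lemma weibull_density_ge0 x : 0 <= w x.
Proof.
by rewrite mulr_ge0 ?expR_ge0// mulr_ge0 ?powR_ge0// divr_ge0// ltW.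
Qed.

Lemma weibull_density_continuous x : 0 < x -> {for x, continuous w}.
Proof.
move=> x0.
have cd : {for x, continuous (fun y : R => y / sc)}.
  by apply: cvgM; [exact: cvg_id|exact: cvg_cst].
have cp (p : R) : {for x, continuous (fun y : R => (y / sc) `^ p)}.
  have := @continuous_powR R p (x / sc) (divr_gt0 x0 sc0).
  exact: continuous_comp cd.
apply: cvgM; first by apply: cvgM; [exact: cvg_cst|exact: cp].
apply: continuous_comp; last exact: continuous_expR.
by apply: cvgN; exact: cp.
Qed.

(** Minus the survival function is the primitive of the density that vanishes at infinity. *)
Lemma weibull_tail_derive x : 0 < x ->
  is_derive x (1 : R) (fun y => - expR (- (y / sc) `^ alpha)) (w x).
Proof.
move=> x0; have xs0 : 0 < x / sc by rewrite divr_gt0.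
have dp := is_derive1_powR alpha xs0.
have dd : is_derive x (1 : R) (fun y : R => y / sc) (sc^-1).
  by apply: is_derive_eq; rewrite /GRing.scale /=; ring.
have dc := @is_derive1_comp _ (@powR R ^~ alpha) (fun y => y / sc) x _ _ dp dd.
have de : is_derive x (1 : R) (fun y => expR (- (y / sc) `^ alpha)) (- w x).
  apply: is_derive_eq.
  rewrite /GRing.scale /weibull_density /=; ring.
apply: is_derive_eq.
by rewrite opprK.
Qed.

Lemma measurable_weibull_density : measurable_fun setT w.
Proof.
have md : measurable_fun setT (fun y : R => y / sc) by exact: measurable_funM.
have mp (p : R) : measurable_fun setT (fun y : R => (y / sc) `^ p).
  by apply: (measurableT_comp (measurable_powR p) md).
apply: measurable_funM; first by apply: measurable_funM.
by apply: measurableT_comp => //; exact: measurableT_comp.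
Qed.

(** Fundamental theorem of calculus on a half-line. Starting at [a > 0] keeps away from the origin,
    where the density is unbounded if [alpha < 1]. *)
Lemma integral_weibull_tail a : 0 < a ->
  (\int[mu]_(x in `[a, +oo[) (w x)%:E = (expR (- (a / sc) `^ alpha))%:E)%E.
Proof.
move=> a0.
rewrite (@ge0_continuous_FTC2y _ _ (fun y => - expR (- (y / sc) `^ alpha)) _ 0).
- by rewrite -EFinB sub0r opprK.
- by move=> x _; exact: weibull_density_ge0.
- apply: continuous_in_subspaceT => x; rewrite inE/= in_itv/= andbT => ax.
  by apply: weibull_density_continuous; exact: lt_le_trans ax.
- rewrite -oppr0; apply: cvgN.
  apply: (@cvg_comp _ _ _ (fun y => (y / sc) `^ alpha)
    (fun u : R => expR (- u)) _ (pinfty_nbhs R));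
    last exact: cvgr_expR.
  apply: (@cvg_comp _ _ _ (fun y => y / sc)
    (fun u : R => u `^ alpha) _ (pinfty_nbhs R));
    last exact: cvgy_powR.
  by apply: gt0_cvgMly; [rewrite invr_gt0|exact: cvg_id].
- by move=> x ax; have [] := weibull_tail_derive (lt_trans a0 ax).
- apply: cvg_at_right_filter.
  have [/derivable1_diffP dF _] := weibull_tail_derive a0.
  exact: differentiable_continuous dF.
- move=> x; rewrite in_itv/= andbT => ax; rewrite derive1E.
  by have [_ ->] := weibull_tail_derive (lt_trans a0 ax).
Qed.

(** Monotone convergence along the half-lines from [1 / (n + 1)]: each tail integral is the
    exponential of a nonpositive number. *)
Lemma integral_weibull_le1 : (\int[mu]_(x in D) (w x)%:E <= 1)%E.
Proof.
have mw : measurable_fun setT (fun x => (w x)%:E).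
  by apply/measurable_EFinP; exact: measurable_weibull_density.
pose F (n : nat) : set R := `[n.+1%:R^-1, +oo[%classic.
have -> : D = \bigcup_n F n.
  apply/seteqP; split=> x /=.
    rewrite in_itv/= andbT => x0; exists (Num.truncn x^-1) => //=.
    rewrite /F/= in_itv/= andbT -[leRHS]invrK lef_pV2 ?posrE ?invr_gt0//.
    by rewrite ltW// truncnS_gt.
  by move=> [n _]; rewrite /F/= !in_itv/= !andbT; apply: lt_le_trans.
have := @ge0_nondecreasing_set_cvg_integral _ (measurableTypeR R) R F
  (fun x => (w x)%:E) mu.
have ndF : nondecreasing_seq F.
  move=> m n mn; rewrite subsetEset => x; rewrite /F /= !in_itv/= !andbT.
  by apply: le_trans; rewrite lef_pV2 ?posrE// ler_nat ltnS.
have mF n : measurable (F n) by exact: measurable_itv.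
have mwF n : measurable_fun (F n) (fun x => (w x)%:E).
  exact: measurable_funTS.
have wF0 n x : F n x -> (0 <= (w x)%:E)%E.
  by rewrite lee_fin weibull_density_ge0.
move=> /(_ ndF mF mwF wF0) /cvg_lim <- //.
apply: lime_le.
  apply: ereal_nondecreasing_is_cvgn.
  exact: (@ge0_nondecreasing_set_nondecreasing_integral _ (measurableTypeR R)).
apply: nearW => n; rewrite integral_weibull_tail// lee_fin -expR0 ler_expR.
by rewrite oppr_le0 powR_ge0.
Qed.

End Weibull.

(** * Laplace transform of a nonnegative density of mass at most 1 *)

Lemma expR_convex_comb (R : realType) (r a b : R) : 0 <= r -> r <= 1 ->
  expR (r * a + (1 - r) * b) <= r * expR a + (1 - r) * expR b.
Proof.
move=> r0 r1; set m := r * a + (1 - r) * b.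
(* The tangent at the barycentre [m] lies below the graph; its values at [a] and [b] average to
   exactly [expR m]. *)
have tangent y : expR m * (1 + (y - m)) <= expR y.
  have -> : expR y = expR m * expR (y - m) by rewrite -expRD addrC subrK.
  by rewrite ler_wpM2l ?expR_ge0// expR_ge1Dx.
have r1' : 0 <= 1 - r by rewrite subr_ge0.
have := lerD (ler_wpM2l r0 (tangent a)) (ler_wpM2l r1' (tangent b)).
by apply: le_trans; rewrite le_eqVlt; apply/predU1P; left; rewrite /m; ring.
Qed.

Section LaplaceTransform.
Variables (R : realType) (w : R -> R).
Local Notation mu := (@lebesgue_measure R).
Local Notation D := `](0 : R), +oo[%classic.
Hypotheses (w_ge0 : forall x, 0 <= w x) (mw : measurable_fun setT w).
Hypothesis w_le1 : (\int[mu]_(x in D) (w x)%:E <= 1)%E.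
Implicit Types r s t x : R.

Definition laplace s : R := \int[mu]_(x in D) (expR (- (s * x)) * w x).

Let integrable_w : mu.-integrable D (EFin \o w).
Proof.
apply/integrableP; split; first by apply/measurable_EFinP/measurable_funTS.
rewrite (le_lt_trans _ (ltry 1))//; apply: le_trans w_le1.
by under eq_integral do rewrite /= ger0_norm//.
Qed.

Lemma integrable_laplace s : 0 <= s ->
  mu.-integrable D (EFin \o (fun x => expR (- (s * x)) * w x)).
Proof.
move=> s0; apply: le_integrable integrable_w => //.
  apply/measurable_EFinP/measurable_funTS; apply: measurable_funM => //.
  by apply: measurableT_comp => //; apply: measurableT_comp => //.
move=> x /=; rewrite in_itv/= andbT lee_fin => x0.
rewrite !ger0_norm ?mulr_ge0 ?expR_ge0// ler_piMl//.
by rewrite -expR0 ler_expR oppr_le0 mulr_ge0// ltW.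
Qed.

Lemma laplace_ge0 s : 0 <= laplace s.
Proof. by apply: Rintegral_ge0 => x _; rewrite mulr_ge0 ?expR_ge0. Qed.

Lemma laplace0_le1 : laplace 0 <= 1.
Proof.
have -> : laplace 0 = \int[mu]_(x in D) w x.
  by apply: eq_Rintegral => x _; rewrite mul0r oppr0 expR0 mul1r.
rewrite -lee_fin fineK//; exact: integrable_fin_num integrable_w.
Qed.

Lemma laplace_nonincreasing s t : 0 <= s -> s <= t -> laplace t <= laplace s.
Proof.
move=> s0 st; apply: le_Rintegral => //.
  exact: integrable_laplace (le_trans s0 st).
  exact: integrable_laplace.
move=> x /=; rewrite in_itv/= andbT => x0.
by rewrite ler_wpM2r// ler_expR lerN2 ler_wpM2r// ltW.
Qed.

(** For each [x] the integrand is convex in the parameter, and integration preserves this. *)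
Lemma laplace_convex r s t : 0 <= r -> r <= 1 -> 0 <= s -> 0 <= t ->
  laplace (r * s + (1 - r) * t) <= r * laplace s + (1 - r) * laplace t.
Proof.
move=> r0 r1 s0 t0; have r1' : 0 <= 1 - r by rewrite subr_ge0.
have is_ := integrable_laplace s0; have it := integrable_laplace t0.
rewrite /laplace -!RintegralZl// -RintegralD//; last 2 first.
- exact: (integrableZl _ _ is_).
- exact: (integrableZl _ _ it).
apply: le_Rintegral => //.
- by apply: integrable_laplace; rewrite addr_ge0 ?mulr_ge0.
- exact: (integrableD _ (integrableZl _ r is_) (integrableZl _ (1 - r) it)).
move=> x _; rewrite !mulrA -mulrDl ler_wpM2r//.
have -> : - ((r * s + (1 - r) * t) * x) =
    r * (- (s * x)) + (1 - r) * (- (t * x)).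
  by ring.
exact: expR_convex_comb.
Qed.

(** Dominated convergence: for parameters in the open window from 0 to [s + 1], which contains [s],
    all integrands are bounded by [w]. *)
Lemma laplace_continuous s : 0 < s -> {for s, continuous laplace}.
Proof.
move=> s0.
pose f t x : R := expR (- (t * x)) * w x.
have If t : `]0, s + 1[%classic t -> mu.-integrable D (EFin \o f t).
  by rewrite /= in_itv/= => /andP[/ltW t0 _]; exact: integrable_laplace.
have cf : {ae mu, forall x, D x ->
    {in `]0, s + 1[%classic, continuous (f ^~ x)}}.
  apply: aeW => x _ t _.
  apply: cvgM; last exact: cvg_cst.
  apply: continuous_comp; last exact: continuous_expR.
  by apply: cvgN; apply: cvgM; [exact: cvg_id|exact: cvg_cst].
have f_le_w t : `]0, s + 1[%classic t ->
    {ae mu, forall x, D x -> `|f t x| <= w x}.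
  rewrite /= in_itv/= => /andP[t0 _]; apply: aeW => x.
  rewrite /= in_itv/= andbT => x0.
  rewrite ger0_norm ?mulr_ge0 ?expR_ge0// ler_piMl//.
  by rewrite -expR0 ler_expR oppr_le0 mulr_ge0// ltW.
apply: (continuity_under_integral _ If cf integrable_w f_le_w) => //.
by rewrite inE/= in_itv/= s0 ltrDl ltr01.
Qed.

(** Cut the integral at [a]. Below, the exponential is at most 1 and the mass at most 1 minus the
    tail; above, the exponential is at most [expR (- (s * a))] and the mass at most 1. *)
Lemma laplace_le_tail s a : 0 <= s -> 0 < a ->
  laplace s <= 1 - \int[mu]_(x in `[a, +oo[) w x + expR (- (s * a)).
Proof.
move=> s0 a0.
pose A := `](0 : R), a[%classic; pose B := `[a, +oo[%classic.
have DE : D = A `|` B.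
  rewrite /A /B; apply/seteqP; split=> x /=; rewrite !in_itv/= ?andbT.
    by move=> ->; have [|] := ltP x a; [left|right].
  by move=> [/andP[]//|]; exact: lt_le_trans.
have AB : [disjoint A & B].
  apply/disj_setPS => x []; rewrite /A /B /= !in_itv/= andbT => /andP[_ xa] ax.
  by have := lt_le_trans xa ax; rewrite ltxx.
have mA : measurable A by exact: measurable_itv.
have mB : measurable B by exact: measurable_itv.
have sA : A `<=` D by rewrite DE; exact: subsetUl.
have sB : B `<=` D by rewrite DE; exact: subsetUr.
have mD : measurable D by exact: measurable_itv.
have iwD := integrable_w; have ilD := integrable_laplace s0.
have split_w : \int[mu]_(x in A) w x + \int[mu]_(x in B) w x <= 1.
  rewrite -Rintegral_setU -?DE//.
  by rewrite -lee_fin fineK//; exact: integrable_fin_num integrable_w.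
have A_ge0 : 0 <= \int[mu]_(x in A) w x by exact: Rintegral_ge0.
have e_ge0 := expR_ge0 (- (s * a)).
rewrite /laplace DE Rintegral_setU -?DE//.
have LA : \int[mu]_(x in A) (expR (- (s * x)) * w x) <= \int[mu]_(x in A) w x.
  apply: le_Rintegral => //.
  - exact: integrableS ilD.
  - exact: integrableS iwD.
  - move=> x; rewrite /A/= in_itv/= => /andP[x0 _]; rewrite ler_piMl//.
    by rewrite -expR0 ler_expR oppr_le0 mulr_ge0// ltW.
have LB : \int[mu]_(x in B) (expR (- (s * x)) * w x) <=
    expR (- (s * a)) * \int[mu]_(x in B) w x.
  have iwB : mu.-integrable B (EFin \o w) by exact: integrableS iwD.
  rewrite -RintegralZl//; apply: le_Rintegral => //.
  - exact: integrableS ilD.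
  - exact: (integrableZl _ _ iwB).
  - move=> x; rewrite /B/= in_itv/= andbT => ax.
    by rewrite ler_wpM2r// ler_expR lerN2 ler_wpM2l.
have : expR (- (s * a)) * \int[mu]_(x in B) w x <= expR (- (s * a)).
  by rewrite ler_piMr// (le_trans _ split_w)// lerDr.
move=> LB1; apply: le_trans (lerD LA (le_trans LB LB1)) _.
by rewrite lerD2r lerBrDr.
Qed.

End LaplaceTransform.

(** * Weibull laws of large scale *)

Lemma weibull_laplace_cvg0 (R : realType) (alpha s : R) : 0 < alpha -> 0 < s ->
  laplace (weibull_density alpha sc) s @[sc --> +oo] --> (0 : R).
Proof.
move=> alpha0 s0; apply/cvgrPdist_le => e e0.
have e2 : 0 < e / 2 by rewrite divr_gt0.
(* Chosen so that [s * a] is the inverse of [e / 2]: since [expR y >= y], the part beyond the cut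
   contributes at most [e / 2]. *)
pose a := (e / 2)^-1 / s.
have a0 : 0 < a by rewrite divr_gt0 ?invr_gt0.
(* The power [alpha] of [q] is [e / 2]. Once [a / sc <= q], the mass below the cut is at most
   [e / 2], because [1 - expR (- u) <= u]. *)
pose q := (e / 2) `^ alpha^-1.
have q0 : 0 < q by rewrite powR_gt0.
near=> sc.
have sc0 : 0 < sc by near: sc; exact: nbhs_pinfty_gt.
have aq : a / q <= sc.
  by near: sc; apply: nbhs_pinfty_ge; exact: num_real.
rewrite sub0r normrN ger0_norm; last first.
  by apply: laplace_ge0 => x; exact: weibull_density_ge0.
apply: le_trans (laplace_le_tail (weibull_density_ge0 alpha0 sc0)
  (measurable_weibull_density alpha sc) (integral_weibull_le1 alpha0 sc0)
  (ltW s0) a0) _.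
rewrite /Rintegral integral_weibull_tail//= (splitr e) lerD//; last first.
  rewrite expRN -[leRHS]invrK lef_pV2 ?posrE ?expR_gt0 ?invr_gt0//.
  have -> : s * a = (e / 2)^-1 by rewrite /a mulrC divfK ?gt_eqF.
  by apply: le_trans (expR_ge1Dx _); rewrite lerDr.
have -> : e / 2 = q `^ alpha.
  by rewrite -powRrM mulVf ?lt0r_neq0// powRr1// ltW.
rewrite lerBlDr -lerBlDl; apply: le_trans (expR_ge1Dx _).
rewrite lerD2l lerN2; apply: ge0_ler_powR; rewrite ?nnegrE ?(ltW alpha0)//.
- by rewrite divr_ge0 ?ltW.
- exact: ltW.
by rewrite ler_pdivrMr// mulrC -ler_pdivrMr.
Unshelve. all: by end_near. Qed.

(** * A fixed-point equation with a convex function *)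

(* [f x = x - T (1 - J x)] is convex with [f 0 <= 0], [f (T / 2) < 0] and
   [f T >= 0], so it has exactly one positive zero, which exceeds [T / 2]. *)
Lemma convex_unique_fixpoint (R : realType) (J : R -> R) (T : R) : 0 < T ->
  (forall x, 0 <= J x) -> J 0 <= 1 -> J (T / 2) < 2^-1 ->
  (forall r s t, 0 <= r -> r <= 1 -> 0 <= s -> 0 <= t ->
     J (r * s + (1 - r) * t) <= r * J s + (1 - r) * J t) ->
  (forall x, 0 < x -> {for x, continuous J}) ->
  exists2 g, T / 2 <= g & forall x, 0 < x -> x = T * (1 - J x) <-> x = g.
Proof.
move=> T0 J_ge0 J0 JT2 convexJ contJ.
pose f x := x - T * (1 - J x).
have T20 : 0 < T / 2 by rewrite divr_gt0.
have f0 : f 0 <= 0.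
  by rewrite /f sub0r oppr_le0 mulr_ge0 ?subr_ge0// ltW.
have fT2 : f (T / 2) < 0.
  have := mulr_gt0 T0 (_ : 0 < 2^-1 - J (T / 2)); rewrite subr_gt0 => /(_ JT2).
  by rewrite /f; lra.
have fT : 0 <= f T by rewrite /f mulrBr mulr1 opprB addrC subrK mulr_ge0// ltW.
have convexf r s t : 0 <= r -> r <= 1 -> 0 <= s -> 0 <= t ->
    f (r * s + (1 - r) * t) <= r * f s + (1 - r) * f t.
  move=> r0 r1 s0 t0; have := ler_wpM2l (ltW T0) (convexJ _ _ _ r0 r1 s0 t0).
  by rewrite /f; lra.
have fE x : x = T * (1 - J x) <-> f x = 0.
  by rewrite /f; split=> [{1}->|/eqP]; [rewrite subrr|rewrite subr_eq0 => /eqP].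
(* Such an [x] is a convex combination of 0 and [T / 2] with positive weight on [T / 2], where [f]
   is negative. *)
have neg_low x : 0 < x -> x <= T / 2 -> f x < 0.
  move=> x0 xT.
  have r0 : 0 < x / (T / 2) by rewrite divr_gt0.
  have r1 : x / (T / 2) <= 1 by rewrite ler_pdivrMr// mul1r.
  have := convexf _ _ _ (ltW r0) r1 (ltW T20) (lexx 0).
  rewrite mulr0 addr0 divfK ?gt_eqF// => /le_lt_trans; apply.
  have := mulr_ge0 (_ : 0 <= 1 - x / (T / 2)) (_ : 0 <= - f 0).
  rewrite subr_ge0 oppr_ge0 => /(_ r1 f0).
  have := mulr_gt0 r0 (_ : 0 < - f (T / 2)); rewrite oppr_gt0 => /(_ fT2).
  lra.
(* Here [y] lies between [T / 2] and [z], with weight [r > 0] on [T / 2]; convexity would give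
   [f y <= r * f (T / 2) < 0]. *)
have no_two y z : T / 2 < y -> y < z -> f y = 0 -> f z = 0 -> False.
  move=> Ty yz fy fz.
  have d0 : 0 < z - T / 2 by rewrite subr_gt0 (lt_trans Ty).
  pose r := (z - y) / (z - T / 2).
  have r0 : 0 < r by rewrite divr_gt0// subr_gt0.
  have r1 : r <= 1 by rewrite ler_pdivrMr// mul1r lerD2l lerN2 ltW.
  have z0 : 0 <= z by rewrite ltW// (lt_trans T20)// (lt_trans Ty).
  have := convexf r _ _ (ltW r0) r1 (ltW T20) z0.
  have -> : r * (T / 2) + (1 - r) * z = y.
    have : r * (z - T / 2) = z - y by rewrite /r divfK ?gt_eqF.
    lra.
  rewrite fy fz mulr0 addr0 leNgt => /negP; apply.
  by rewrite pmulr_rlt0.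
have [g gI fg] : exists2 g, g \in `[T / 2, T] & f g = 0.
  have T2T : T / 2 <= T by lra.
  apply: (IVT T2T).
    apply: continuous_in_subspaceT => x; rewrite inE/= in_itv/= => /andP[Tx _].
    apply: cvgB; first exact: cvg_id.
    apply: cvgM; first exact: cvg_cst.
    apply: cvgB; first exact: cvg_cst.
    by apply: contJ; exact: lt_le_trans Tx.
  by rewrite ge_min le_max (ltW fT2) fT orbT.
have {gI} Tg : T / 2 <= g by move: gI; rewrite in_itv/= => /andP[].
exists g => // x x0; rewrite fE; split=> [fx|->//].
have above y : 0 < y -> f y = 0 -> T / 2 < y.
  move=> y0 fy; rewrite ltNge; apply/negP => /(neg_low _ y0).
  by rewrite fy ltxx.
have Tx := above x x0 fx.
have {}Tg := above g (lt_le_trans T20 Tg) fg.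
have [xg|gx|//] := ltgtP x g.
  by case: (no_two _ _ Tx xg fx fg).
by case: (no_two _ _ Tg gx fg fx).
Qed.

(** * Stationary points and maxima of [exp (- a x - c / x)] *)

Lemma log_stationary_exp_linear_inverse (R : realType) (a c b : R) : 0 < b ->
  log_stationary (fun x => expR (- (a * x)) * expR (- (c / x))) b <->
  a * b ^+ 2 = c.
Proof.
move=> b0; have bN0 : b != 0 by rewrite gt_eqF.
have D : is_derive b (1 : R)
    (fun x => ln (expR (- (a * x)) * expR (- (c / x)))) (- a + c / b ^+ 2).
  have -> : (fun x => ln (expR (- (a * x)) * expR (- (c / x)))) =
            (fun x : R => - (a * x) - c * x^-1).
    by apply/funext => x; rewrite -expRD expRK.
  have dV := is_deriveV bN0 (is_derive_id b (1 : R)).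
  apply: is_derive_eq.
  by rewrite /GRing.scale /=; ring.
rewrite /log_stationary; split => [H|H].
  have := @derive_val _ _ _ _ _ _ _ D.
  rewrite (@derive_val _ _ _ _ _ _ _ H) => E.
  have -> : a = c / b ^+ 2 by lra.
  by field.
apply: (is_derive_eq D); rewrite -H; field => //.
Qed.

Lemma maximizes_exp_linear_inverse (R : realType) (a c b : R) :
  0 < a -> 0 < b ->
  maximizes (fun x => expR (- (a * x)) * expR (- (c / x))) b <->
  a * b ^+ 2 = c.
Proof.
move=> a0 b0.
have gap y x : 0 < y -> 0 < x -> a * y ^+ 2 = c ->
    (a * x + c / x) - (a * y + c / y) = a * (x - y) ^+ 2 / x.
  by move=> y0 x0 <-; field; rewrite !gt_eqF.
split=> [[_ H]|H]; last first.
  split=> // x x0; rewrite -!expRD ler_expR -!opprD lerN2 -subr_ge0 gap//.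
  by rewrite divr_ge0 ?(ltW x0)// mulr_ge0 ?sqr_ge0// ltW.
have {}H x : 0 < x -> a * b + c / b <= a * x + c / x.
  by move/H; rewrite -!expRD ler_expR -!opprD lerN2.
(* For [c > 0], compare [b] with the root of [a * y ^+ 2 = c]: by [gap], the maximality of [b]
   forces the square to vanish. *)
have [c0|c0] := ltP 0 c.
  have y0 : 0 < Num.sqrt (c / a) by rewrite sqrtr_gt0 divr_gt0.
  have ey : a * Num.sqrt (c / a) ^+ 2 = c.
    by rewrite sqr_sqrtr ?divr_ge0 ?ltW// mulrC divfK ?gt_eqF.
  have := H _ y0; rewrite -subr_le0 gap// pmulr_lle0 ?invr_gt0// pmulr_rle0//.
  move=> le0; have : (b - Num.sqrt (c / a)) ^+ 2 == 0.
    by rewrite eq_le le0 sqr_ge0.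
  by rewrite sqrf_eq0 subr_eq0 => /eqP ->.
(* For [c <= 0] there is no maximizer: halving [b] strictly lowers [a * b + c / b]. *)
have := H (b / 2) ltac:(lra); have bi : 0 < b^-1 by rewrite invr_gt0.
have -> : c / (b / 2) = 2 * (c / b) by field; rewrite gt_eqF.
have : c / b <= 0 by rewrite pmulr_lle0.
by have := mulr_gt0 a0 b0; lra.
Qed.

(** * Optimal bandwidth and threshold when the value of J is fixed *)

Section Optimality.
Variables (R : realType) (S : radar R) (rho rt : R).
Hypothesis rt0 : 0 < rt.

(** [noise] and [clutter] are the coefficients of [BW] and [1 / BW] in [-ln P_DC]; the factor 2
    cancels against the cell size [c / (2 BW)]. *)
Let noise gamma : R := boltzmann S * noise_temp S * gamma /
  (tx_power S * path_loss S rt * target_rcs S).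
Let clutter j : R := pi * rho * (1 - j) * rt * light_speed S.

Let gain_gt0 : 0 < tx_power S * path_loss S rt * target_rcs S.
Proof.
by rewrite !mulr_gt0 ?tx_power_gt0 ?target_rcs_gt0//; exact: path_loss_gt0.
Qed.

Let noise_gt0 gamma : 0 < gamma -> 0 < noise gamma.
Proof.
move=> g0; apply: divr_gt0 gain_gt0.
by rewrite !mulr_gt0 ?boltzmann_gt0 ?noise_temp_gt0.
Qed.

Lemma coverage_at_exp j gamma : coverage_at S rho rt j gamma =
  (fun x => expR (- (noise gamma * x)) * expR (- (clutter j / x))).
Proof.
apply/funext => x; rewrite /coverage_at; congr (expR _ * expR _).
  by rewrite /noise mulNr; congr (- _); ring.
by rewrite /clutter invfM; congr (- _); move: x^-1 => y; field.
Qed.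

Lemma opt_bandwidth_quadratic j gamma b : 0 < gamma -> 0 < b ->
  b = opt_bandwidth S rho rt j gamma <-> noise gamma * b ^+ 2 = clutter j.
Proof.
move=> g0 b0; have n0 := noise_gt0 g0.
have -> : opt_bandwidth S rho rt j gamma = Num.sqrt (clutter j / noise gamma).
  congr Num.sqrt; rewrite /clutter /noise; field.
  by rewrite !gt_eqF ?tx_power_gt0 ?path_loss_gt0 ?target_rcs_gt0
    ?boltzmann_gt0 ?noise_temp_gt0.
split=> [e|<-]; last first.
  by rewrite mulrAC divff ?gt_eqF// mul1r sqrtr_sqr gtr0_norm.
(* Positivity of [b] excludes the default value 0 of [Num.sqrt] on negative arguments, so squaring
   undoes the root. *)
move: b0; rewrite e sqrtr_gt0 => y0; rewrite sqr_sqrtr ?ltW//.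
by rewrite mulrC divfK ?gt_eqF.
Qed.

Lemma coverage_at_stationary j gamma b : 0 < gamma -> 0 < b ->
  log_stationary (coverage_at S rho rt j gamma) b <->
  b = opt_bandwidth S rho rt j gamma.
Proof.
move=> g0 b0; rewrite opt_bandwidth_quadratic// coverage_at_exp.
exact: log_stationary_exp_linear_inverse.
Qed.

Lemma coverage_at_maximizes j gamma b : 0 < gamma -> 0 < b ->
  maximizes (coverage_at S rho rt j gamma) b <->
  b = opt_bandwidth S rho rt j gamma.
Proof.
move=> g0 b0; rewrite opt_bandwidth_quadratic// coverage_at_exp.
exact: maximizes_exp_linear_inverse (noise_gt0 g0) b0.
Qed.

(** The same quadratic relation solved for [gamma]. With [j] the actual J at [gamma], it turns into
    a fixed-point equation. *)
Lemma opt_bandwidth_threshold j gamma b : 0 < gamma -> 0 < b ->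
  b = opt_bandwidth S rho rt j gamma <->
  gamma = threshold S rho b rt * (1 - j).
Proof.
move=> g0 b0; rewrite opt_bandwidth_quadratic//.
have -> : threshold S rho b rt * (1 - j) = clutter j *
    (tx_power S * path_loss S rt * target_rcs S) /
    (boltzmann S * noise_temp S * b ^+ 2).
  by rewrite /threshold /clutter; ring.
rewrite /noise; split=> [<-|{1}->]; field; rewrite !gt_eqF ?boltzmann_gt0
  ?noise_temp_gt0 ?tx_power_gt0 ?path_loss_gt0 ?target_rcs_gt0//.
Qed.

Lemma threshold_gt0 b : 0 < rho -> 0 < b -> 0 < threshold S rho b rt.
Proof.
move=> r0 b0; rewrite divr_gt0 ?mulr_gt0 ?exprn_gt0 ?pi_gt0 ?boltzmann_gt0
  ?noise_temp_gt0 ?light_speed_gt0 ?tx_power_gt0 ?path_loss_gt0//.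
exact: target_rcs_gt0.
Qed.

End Optimality.

(** * The clutter integral J as a rescaled Laplace transform *)

Section Clutter.
Variables (R : realType) (S : radar R) (alpha : R).
Hypothesis alpha0 : 0 < alpha.
Implicit Types sc gamma : R.

Lemma clutter_JE sc gamma : clutter_J S alpha sc gamma =
  laplace (weibull_density alpha sc) (gamma / target_rcs S).
Proof. by apply: eq_Rintegral => x _; rewrite mulrAC. Qed.

Lemma clutter_J_ge0 sc gamma : 0 < sc -> 0 <= clutter_J S alpha sc gamma.
Proof.
by move=> sc0; rewrite clutter_JE laplace_ge0// => x;
  exact: weibull_density_ge0.
Qed.

Lemma clutter_J_nonincreasing sc gamma gamma' : 0 < sc -> 0 <= gamma ->
  gamma <= gamma' -> clutter_J S alpha sc gamma' <= clutter_J S alpha sc gamma.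
Proof.
move=> sc0 g0 gg'; have t0 := target_rcs_gt0 S; rewrite !clutter_JE.
apply: (laplace_nonincreasing (weibull_density_ge0 alpha0 sc0)
  (measurable_weibull_density alpha sc) (integral_weibull_le1 alpha0 sc0)).
  by rewrite divr_ge0// ltW.
by rewrite ler_pM2r ?invr_gt0.
Qed.

Lemma clutter_J_cvg0 gamma : 0 < gamma ->
  clutter_J S alpha sc gamma @[sc --> +oo] --> (0 : R).
Proof.
move=> g0; under eq_cvg do rewrite clutter_JE.
by apply: weibull_laplace_cvg0; rewrite // divr_gt0 ?target_rcs_gt0.
Qed.

Lemma clutter_J_unique_fixpoint sc T : 0 < sc -> 0 < T ->
  clutter_J S alpha sc (T / 2) < 2^-1 ->
  exists2 g, T / 2 <= g &
    forall x, 0 < x -> x = T * (1 - clutter_J S alpha sc x) <-> x = g.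
Proof.
move=> sc0 T0 JT2; have t0 := target_rcs_gt0 S.
have w0 := weibull_density_ge0 alpha0 sc0.
have mw := measurable_weibull_density alpha sc.
have w1 := integral_weibull_le1 alpha0 sc0.
apply: convex_unique_fixpoint => //.
- by move=> x; exact: clutter_J_ge0.
- by rewrite clutter_JE mul0r; exact: laplace0_le1.
- move=> r s t r0 r1 s0 t_0; rewrite !clutter_JE.
  rewrite mulrDl -!mulrA.
  by apply: laplace_convex => //; rewrite divr_ge0// ltW.
- move=> x x0; have xt0 : 0 < x / target_rcs S by rewrite divr_gt0.
  have -> : clutter_J S alpha sc =
      laplace (weibull_density alpha sc) \o (fun y => y / target_rcs S).
    by apply/funext => y /=; rewrite clutter_JE.
  apply: continuous_comp; first by apply: cvgM; [exact: cvg_id|exact: cvg_cst].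
  exact: laplace_continuous.
Qed.

End Clutter.

(** * The optimal threshold for large clutter cross-sections *)

Theorem corollary2p1 (R : realType) (S : radar R) (rho : R) (BW : R) (rt : R)
    (rho_gt0 : 0 < rho) (BW_gt0 : 0 < BW) (rt_gt0 : 0 < rt) :
  (* at J = 0: the optimum bandwidth formula, solved for the threshold *)
  (forall gamma : R, 0 < gamma ->
    [/\ BW = opt_bandwidth S rho rt 0 gamma <-> gamma = threshold S rho BW rt,
        log_stationary (coverage_at S rho rt 0 gamma) BW <->
          gamma = threshold S rho BW rt
      & maximizes (coverage_at S rho rt 0 gamma) BW <->
          gamma = threshold S rho BW rt]) /\
  (* whatever the shape parameter of the clutter *)
  (forall alpha : R, 0 < alpha ->
    [/\ (* J and P_DC for large clutter cross-sections *)
        forall gamma : R, 0 < gamma ->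
          clutter_J S alpha sc gamma @[sc --> +oo] --> (0 : R) /\
          (forall b : R, 0 < b ->
            coverage S rho alpha sc rt gamma b @[sc --> +oo] -->
              coverage_at S rho rt 0 gamma b),
        (* the optimum bandwidth formula *)
        forall sc gamma b : R, 0 < sc -> 0 < gamma -> 0 < b ->
          (log_stationary (coverage S rho alpha sc rt gamma) b <->
             b = opt_bandwidth S rho rt (clutter_J S alpha sc gamma) gamma) /\
          (maximizes (coverage S rho alpha sc rt gamma) b <->
             b = opt_bandwidth S rho rt (clutter_J S alpha sc gamma) gamma)
      & (* the threshold at which the given BW is optimal, for large clutter
           cross-sections *)
        exists gopt : R -> R,
          (\forall sc \near +oo, 0 < gopt sc /\
             forall gamma : R, 0 < gamma ->
               (maximizes (coverage S rho alpha sc rt gamma) BW <->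
                gamma = gopt sc)) /\
          gopt sc @[sc --> +oo] --> threshold S rho BW rt]).

Proof.
have at0 gamma : 0 < gamma ->
    BW = opt_bandwidth S rho rt 0 gamma <-> gamma = threshold S rho BW rt.
  by move=> g0; rewrite opt_bandwidth_threshold// subr0 mulr1.
split=> [gamma g0|alpha alpha0].
  split; first exact: at0.
    by rewrite coverage_at_stationary//; exact: at0.
  by rewrite coverage_at_maximizes//; exact: at0.
split.
- move=> gamma g0; have J0 := clutter_J_cvg0 S alpha0 g0.
  (* Only the second exponential involves J, and it depends continuously on it. *)
  split=> // b b0; apply: cvgM; first exact: cvg_cst.
  apply: continuous_cvg; first exact: continuous_expR.
  apply: cvgN; apply: cvgM; last exact: cvg_cst.
  apply: cvgM; last exact: cvg_cst.
  apply: cvgM; first exact: cvg_cst.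
  by apply: cvgB; first exact: cvg_cst.
- move=> sc gamma b sc0 g0 b0; split.
    exact: coverage_at_stationary.
  exact: coverage_at_maximizes.
set T := threshold S rho BW rt.
have T0 : 0 < T by exact: threshold_gt0.
have T20 : 0 < T / 2 by rewrite divr_gt0.
pose fixed sc : set R := [set g | T / 2 <= g /\
  forall x, 0 < x -> x = T * (1 - clutter_J S alpha sc x) <-> x = g].
(* [T] is the default where [fixed sc] is empty; [goptP] shows that this stops once J at [T / 2] is
   below one half. *)
pose gopt sc : R := xget T (fixed sc).
have JT2 := clutter_J_cvg0 S alpha0 T20.
have goptP : \forall sc \near +oo, 0 < sc /\ fixed sc (gopt sc).
  near=> sc; have sc0 : 0 < sc by near: sc; exact: nbhs_pinfty_gt.
  split=> //; apply: xgetPex.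
  have [|g Tg gP] := @clutter_J_unique_fixpoint _ S _ alpha0 sc T sc0 T0.
    by near: sc; apply: (cvgr_lt _ JT2); rewrite invr_gt0.
  by exists g.
exists gopt; split.
  near=> sc.
  have [sc0 [Tg gP]] : 0 < sc /\ fixed sc (gopt sc) by near: sc.
  split=> [|gamma g0]; first exact: lt_le_trans Tg.
  rewrite -gP//.
  (* J does not involve the bandwidth, so for each [gamma] its value can be taken as the constant
     [j]. *)
  have optE := @coverage_at_maximizes _ S rho rt rt_gt0
    (clutter_J S alpha sc gamma) gamma BW g0 BW_gt0.
  by apply: (iff_trans optE); exact: opt_bandwidth_threshold.
(* Squeeze: as [gopt sc] is at least [T / 2] and J is nonincreasing, the fixed-point equation puts
   [gopt sc] between this bound and [T]. *)
have lower : T * (1 - clutter_J S alpha sc (T / 2)) @[sc --> +oo]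
    --> T * (1 - 0).
  apply: cvgM; first exact: cvg_cst.
  by apply: cvgB; first exact: cvg_cst.
rewrite subr0 mulr1 in lower; apply: (squeeze_cvgr _ lower (cvg_cst T)).
near=> sc.
have [sc0 [Tg gP]] : 0 < sc /\ fixed sc (gopt sc) by near: sc.
have gE : gopt sc = T * (1 - clutter_J S alpha sc (gopt sc)).
  by apply/gP => //; exact: lt_le_trans Tg.
rewrite {1 2}gE; apply/andP; split.
  by rewrite ler_pM2l// lerD2l lerN2 clutter_J_nonincreasing// ltW.
by rewrite ler_piMr ?(ltW T0)// gerBl clutter_J_ge0.
Unshelve. all: by end_near. Qed.
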